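(* Let $t>1$ be an odd natural number, $n=2t+1$, and let $k$ be a natural number with $\gcd(k,n)=1$. Then the odd Niho exponent $2^t+2^{(3t+1)/2}-1$ never lies in the cyclotomic coset of $e(l,k)$ modulo $2^n-1$, for any natural number $l$.
   Context: For natural numbers $l,k$, $e(l,k)=\sum_{j=0}^{l-1}2^{jk}$. The cyclotomic coset of $d$ modulo $2^n-1$ is $\{2^a d \bmod (2^n-1): a\ge 0\}$. *)

(* Defs.v *)
From mathcomp Require Import all_boot.
Set Implicit Arguments.
Unset Strict Implicit.
Unset Printing Implicit Defensive.

Definition e (l k : nat) : nat := \sum_(0 <= j < l) 2 ^ (j * k).

Definition cyclotomic_coset (n d : nat) (x : nat) : Prop :=
  exists a : nat, x = (2 ^ a * d) %% (2 ^ n - 1).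

(* [3 * t + 1] is even for odd [t], so the division is then exact. *)
Definition odd_niho (t : nat) : nat := 2 ^ t + 2 ^ ((3 * t + 1) %/ 2) - 1.

(* Main.v *)
Require Import Defs.
From mathcomp Require Import all_boot zify.

Set Implicit Arguments.
Unset Strict Implicit.
Unset Printing Implicit Defensive.

(** Modulo [2 ^ n - 1] the powers of two multiply like the residues modulo [n],
    so [2 ^ a * e l k] is the number whose binary digits sit on the arithmetic
    progression [a, a + k, ..., a + (r - 1) k] of residues modulo [n], where
    [r = l mod n].  Hence if the exponent lay in the coset, its set of digits
    [A = {0, ..., t - 1, (3 t + 1) / 2}] would be such a progression, and all
    elements of [A] but at most one would stay in [A] after adding [k]; likewise
    after subtracting [k].  One of [k] and [- k] is congruent to some [d] with
    [1 <= d <= t], and translating [A] by such a [d] always moves at least two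
    elements out of [A]. *)

Section BinaryDigits.

(** Induction on [n] from the lowest digit: parity determines it, and what remains is twice a
    shorter sum. *)
Lemma sum_digits_inj (n : nat) (f g : nat -> bool) :
  \sum_(0 <= i < n) f i * 2 ^ i = \sum_(0 <= i < n) g i * 2 ^ i ->
  forall i, i < n -> f i = g i.
Proof.
elim: n f g => [|n IHn] f g //; rewrite !big_nat_recl // !expn0 !muln1.
have shift (h : nat -> bool) :
    \sum_(0 <= i < n) h i.+1 * 2 ^ i.+1 =
    (\sum_(0 <= i < n) h i.+1 * 2 ^ i).*2.
  by rewrite -mul2n big_distrr; apply: eq_bigr => i _; rewrite expnS mulnCA.
rewrite !shift => sum_eq.
have eq0 : f 0 = g 0.
  by move/(congr1 odd): sum_eq; rewrite !oddD !odd_double;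
    case: (f 0) (g 0) => [] [].
have /IHn eqS : \sum_(0 <= i < n) f i.+1 * 2 ^ i =
                \sum_(0 <= i < n) g i.+1 * 2 ^ i.
  by apply/double_inj/eqP; rewrite -(eqn_add2l (f 0)) {2}eq0; apply/eqP.
by case=> [//|i]; rewrite ltnS => /eqS.
Qed.

Lemma sum_pow2_digits (n : nat) (s : seq nat) :
  uniq s -> all (fun i => i < n) s ->
  \sum_(i <- s) 2 ^ i = \sum_(0 <= i < n) (i \in s) * 2 ^ i.
Proof.
move=> s_uniq /allP s_lt.
rewrite [RHS](eq_bigr (fun i => if i \in s then 2 ^ i else 0)); last first.
  by move=> i _; case: (i \in s); rewrite ?mul1n ?mul0n.
rewrite -big_mkcond -[RHS]big_filter; apply: perm_big; apply: uniq_perm => //.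
  exact/filter_uniq/iota_uniq.
move=> i; rewrite mem_filter mem_index_iota.
by case s_i: (i \in s) => //=; rewrite s_lt.
Qed.

Lemma sum_pow2_inj (n : nat) (s1 s2 : seq nat) :
  uniq s1 -> all (fun i => i < n) s1 -> uniq s2 -> all (fun i => i < n) s2 ->
  \sum_(i <- s1) 2 ^ i = \sum_(i <- s2) 2 ^ i -> s1 =i s2.
Proof.
move=> u1 b1 u2 b2; rewrite (sum_pow2_digits u1 b1) (sum_pow2_digits u2 b2).
move=> /sum_digits_inj eq_mem i; case: (ltnP i n) => [/eq_mem // | le_ni].
by apply/idP/idP => [/(allP b1)|/(allP b2)] /=; rewrite ltnNge le_ni.
Qed.

Lemma sum_pow2_iota (t : nat) : \sum_(i <- iota 0 t) 2 ^ i = 2 ^ t - 1.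
Proof.
by rewrite subn1 predn_exp mul1n -[in LHS](subn0 t) big_mkord.
Qed.

Lemma expn2_modn (n m : nat) : 2 ^ (m %% n) = 2 ^ m %[mod 2 ^ n - 1].
Proof.
have pow_n : 2 ^ n = 1 %[mod 2 ^ n - 1].
  by apply/eqP; rewrite eqn_mod_dvd ?expn_gt0.
rewrite [in RHS](divn_eq m n) expnD (mulnC _ n) expnM -modnMml.
by rewrite -[in RHS]modnXm pow_n modnXm exp1n modnMml mul1n.
Qed.

End BinaryDigits.

Section Progression.

Variables (n k : nat).
Hypotheses (n_gt1 : 1 < n) (k_coprime : coprime k n).

Definition progression (a r : nat) : seq nat :=
  [seq (a + j * k) %% n | j <- iota 0 r].

Lemma progression_lt a r : all (fun i => i < n) (progression a r).
Proof. by apply/allP => i /mapP[j _ ->]; rewrite ltn_mod ltnW. Qed.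

(** As [k] is invertible modulo [n], equal terms have indices differing by a multiple of [n], while
    indices below [r <= n] differ by less than [n]. *)
Lemma progression_uniq a r : r <= n -> uniq (progression a r).
Proof.
move=> le_rn; rewrite map_inj_in_uniq ?iota_uniq // => i j.
rewrite !mem_iota !add0n => /= lt_i lt_j /eqP; rewrite eqn_modDl.
wlog le_ij : i j lt_i lt_j / i <= j.
  by move=> W; case: (leqP i j) => [|/ltnW] le eq; [|symmetry];
    apply: W => //; rewrite eq_sym.
rewrite eq_sym eqn_mod_dvd ?leq_mul2r ?le_ij ?orbT // -mulnBl.
rewrite Gauss_dvdl 1?coprime_sym // => dvd_n.
apply/eqP; rewrite eqn_leq le_ij -subn_eq0.
case: posnP dvd_n => // pos /(dvdn_leq pos); lia.
Qed.

Lemma sum_progression a r :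
  \sum_(i <- progression a r) 2 ^ i = 2 ^ a * e r k %[mod 2 ^ n - 1].
Proof.
rewrite /e /progression big_map /index_iota subn0 big_distrr /=.
elim: (iota 0 r) => [|j s IHs]; first by rewrite !big_nil.
by rewrite !big_cons -modnDm IHs expn2_modn -expnD modnDm.
Qed.

Lemma progression_full a : \sum_(i <- progression a n) 2 ^ i = 2 ^ n - 1.
Proof.
rewrite -sum_pow2_iota; apply: perm_big; apply: uniq_perm.
- exact: progression_uniq.
- exact: iota_uniq.
have [] := @uniq_min_size _ (progression a n) (iota 0 n).
- exact: progression_uniq.
- by move=> i /(allP (progression_lt a n)); rewrite mem_iota.
- by rewrite size_map.
- by [].
Qed.

Lemma progression_cat a r m :
  \sum_(i <- progression a (r + m)) 2 ^ i =
  \sum_(i <- progression a r) 2 ^ i +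
  \sum_(i <- progression (a + r * k) m) 2 ^ i.
Proof.
rewrite /progression iotaD map_cat big_cat add0n /=; congr (_ + _).
rewrite -[r in iota r _]addn0 iotaDl !big_map; apply: eq_bigr => j _.
by rewrite mulnDl addnA.
Qed.

(** A block of [n] consecutive terms runs through all residues, so it sums to [2 ^ n - 1], which is
    0 here; dropping it moves the start by [n * k], invisible modulo [n]. *)
Lemma sum_progression_modn a l :
  \sum_(i <- progression a l) 2 ^ i =
  \sum_(i <- progression a (l %% n)) 2 ^ i %[mod 2 ^ n - 1].
Proof.
rewrite {1}(divn_eq l n); elim: (l %/ n) a => [|q IHq] a //.
rewrite mulSn -addnA progression_cat progression_full modnDl IHq.
by congr ((\sum_(i <- _) _) %% _); apply: eq_map => j;
  rewrite -addnA addnCA mulnC modnMDl.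
Qed.

(** Appending the [n - r] missing terms, at least one, strictly increases the sum and brings it to
    [2 ^ n - 1]. *)
Lemma sum_progression_lt a r :
  r < n -> \sum_(i <- progression a r) 2 ^ i < 2 ^ n - 1.
Proof.
move=> lt_rn; rewrite -(progression_full a) -(subnKC lt_rn) addSnnS.
rewrite progression_cat -[X in X < _]addn0 ltn_add2l /progression /= big_cons.
by rewrite addn_gt0 expn_gt0.
Qed.

Lemma progression_addk a r x :
  x \in progression a r -> x != (a + r.-1 * k) %% n ->
  (x + k) %% n \in progression a r.
Proof.
case/mapP=> j; rewrite mem_iota => /= lt_jr -> neq.
have lt_Sjr : j.+1 < r.
  case: (ltngtP j.+1 r) => // [|eq_r]; first by lia.
  by move: neq; rewrite -eq_r eqxx.
apply/mapP; exists j.+1; first by rewrite mem_iota.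
by rewrite modnDml -addnA (addnC _ k) mulSn.
Qed.

(** Only the first term lacks a predecessor; [n - k %% n] represents [- k] within [nat]. *)
Lemma progression_subk a r x :
  x \in progression a r -> x != a %% n ->
  (x + (n - k %% n)) %% n \in progression a r.
Proof.
case/mapP=> -[|j]; rewrite mem_iota; first by move=> _ ->; rewrite addn0 eqxx.
move=> /= lt_jr -> _; apply/mapP; exists j; first by rewrite mem_iota; lia.
have le_kn : k %% n <= n by rewrite ltnW // ltn_mod ltnW.
have -> : n - k %% n = (k %/ n).+1 * n - k.
  by rewrite {3}(divn_eq k n) mulSn addnC subnDl.
have le_k : k <= (k %/ n).+1 * n.
  by rewrite {1}(divn_eq k n) mulSn addnC leq_add2r.
by rewrite modnDml mulSn addnCA (addnC k) -addnA subnKC // addnC modnMDl.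
Qed.

End Progression.

Section NihoDigits.

Variable t : nat.
Hypothesis (t_gt2 : 2 < t).

Definition niho_digits : seq nat := (3 * t + 1) %/ 2 :: iota 0 t.

Lemma mem_niho_digits x :
  (x \in niho_digits) = (x == (3 * t + 1) %/ 2) || (x < t).
Proof. by rewrite inE mem_iota. Qed.

Lemma niho_digits_uniq : uniq niho_digits.
Proof. by rewrite /= mem_iota iota_uniq; lia. Qed.

Lemma niho_digits_lt : all (fun i => i < 2 * t + 1) niho_digits.
Proof. apply/allP => i; rewrite mem_niho_digits; lia. Qed.

Lemma sum_niho_digits : \sum_(i <- niho_digits) 2 ^ i = odd_niho t.
Proof.
by rewrite big_cons sum_pow2_iota /odd_niho addnC addnBAC // expn_gt0.
Qed.

(* The two elements moved out are [t - 1] and [(3 t + 1) / 2] for [d = 1],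
   [t - 1] and [t - 2] for [d = 2], and two of [t - 1], [t - 2], [t - 3] for
   [d >= 3], whose translates lie in [t, 2 t - 1], where only [(3 t + 1) / 2]
   is a digit. *)
Lemma niho_digits_not_shift_stable d x0 :
  0 < d <= t ->
  ~ (forall x, x \in niho_digits -> x != x0 ->
       (x + d) %% (2 * t + 1) \in niho_digits).
Proof.
move=> d_bounds stable.
(* Shifts that do not wrap around suffice, and for them the reduction modulo [2 * t + 1]
   disappears. *)
have step x : (x == (3 * t + 1) %/ 2) || (x < t) -> x + d < 2 * t + 1 ->
    x != x0 -> (x + d == (3 * t + 1) %/ 2) || (x + d < t).
  move=> Ax lt_xd neq; rewrite -mem_niho_digits -(modn_small lt_xd).
  by apply: stable; rewrite ?mem_niho_digits.
have := step ((3 * t + 1) %/ 2); have := step (t - 1).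
have := step (t - 2); have := step (t - 3).
lia.
Qed.

End NihoDigits.

Theorem theorem8 (t n k : nat) (t_gt1 : 1 < t) (t_odd : odd t)
    (n_def : n = 2 * t + 1) (k_coprime : gcdn k n = 1) :
  forall l : nat, ~ cyclotomic_coset n (e l k) (odd_niho t).
Proof.
move=> l [a].
(* Oddness excludes [t = 2], where the digits 1, 3, 0 do form a progression modulo 5. *)
have t_gt2 : 2 < t by case: t t_gt1 t_odd {n_def} => [|[|[|]]].
have n_gt1 : 1 < n by lia.
have cop : coprime k n by rewrite /coprime k_coprime.
have lt_r : l %% n < n by rewrite ltn_mod ltnW.
(* With fewer than [n] terms the sum is its own residue, so the congruence becomes an equality of
   binary expansions. *)
rewrite -sum_progression sum_progression_modn // modn_small; last first.
  exact: sum_progression_lt.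
set s := progression n k a (l %% n); rewrite -sum_niho_digits => sum_eq.
have digits : niho_digits t =i s.
  apply: (@sum_pow2_inj n) sum_eq.
  - exact: niho_digits_uniq.
  - by rewrite n_def niho_digits_lt.
  - exact: (progression_uniq n_gt1 cop a (ltnW lt_r)).
  - exact: progression_lt.
have k_pos : 0 < k %% n.
  by rewrite lt0n -/(dvdn n k); apply/negP => /gcdn_idPr; lia.
have k_lt : k %% n < n by rewrite ltn_mod ltnW.
(* The shift by [k] exempts the last term of the progression, the shift by [- k] the first. *)
case: (leqP (k %% n) t) => cmp.
  apply: (@niho_digits_not_shift_stable t t_gt2 (k %% n)
            ((a + (l %% n).-1 * k) %% n)); first by rewrite k_pos.
  by move=> x; rewrite -n_def modnDmr !digits; apply: progression_addk.
apply: (@niho_digits_not_shift_stable t t_gt2 (n - k %% n) (a %% n)).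
  by lia.
by move=> x; rewrite -n_def !digits; apply: progression_subk.
Qed.
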